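(* Let $\mathcal{G}$ be a $\widetilde{\mathbb{C}}$-module and let $\mathcal{P}$ and $\mathcal{Q}$ be two ultra-pseudo-norms on $\mathcal{G}$, each of which gives $\mathcal{G}$ the structure of a Banach $\widetilde{\mathbb{C}}$-module. If there is $C>0$ such that $\mathcal{Q}(u)\le C\mathcal{P}(u)$ for all $u\in\mathcal{G}$, then $\mathcal{P}$ and $\mathcal{Q}$ are equivalent, i.e. there exist constants $C_1,C_2>0$ such that $C_1\mathcal{P}(u)\le\mathcal{Q}(u)\le C_2\mathcal{P}(u)$ for all $u\in\mathcal{G}$.
   Context: Generalized numbers: $\widetilde{\mathbb{C}}=\mathcal{E}_M/\mathcal{N}$, where $\mathcal{E}_M$ is the ring of nets $(c_\varepsilon)_\varepsilon\in\mathbb{C}^{(0,1]}$ with $|c_\varepsilon|=O(\varepsilon^{-N})$ as $\varepsilon\to0$ for some $N\in\mathbb{N}$, and $\mathcal{N}$ is the ideal of nets with $|c_\varepsilon|=O(\varepsilon^{q})$ for all $q\in\mathbb{N}$; $[(c_\varepsilon)_\varepsilon]$ denotes the class of $(c_\varepsilon)_\varepsilon$. The valuation is $\mathrm{v}(c)=\sup\{b\in\mathbb{R}: |c_\varepsilon|=O(\varepsilon^b)\text{ as }\varepsilon\to0\}$ and $|c|_{\mathrm e}=e^{-\mathrm{v}(c)}$. An ultra-pseudo-norm on a $\widetilde{\mathbb{C}}$-module $\mathcal{G}$ is a map $\mathcal{P}:\mathcal{G}\to[0,\infty)$ such that: $\mathcal{P}(u)=0$ if and only if $u=0$; $\mathcal{P}(\lambda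 u)\le|\lambda|_{\mathrm e}\mathcal{P}(u)$ for all $\lambda\in\widetilde{\mathbb{C}}$; $\mathcal{P}([(c\,\varepsilon^a)_\varepsilon]u)=e^{-a}\mathcal{P}(u)$ for all $c\in\mathbb{C}\setminus\{0\}$, $a\in\mathbb{R}$; and $\mathcal{P}(u+v)\le\max\{\mathcal{P}(u),\mathcal{P}(v)\}$. $(\mathcal{G},\mathcal{P})$ is a Banach $\widetilde{\mathbb{C}}$-module if $\mathcal{G}$ is complete for the metric $\mathcal{P}(u-v)$. *)

(* Defs.v *)
From HB Require Import structures.
From mathcomp Require Import all_boot all_order all_algebra.
From mathcomp Require Import generic_quotient ring_quotient.
From mathcomp Require Import complex.
From mathcomp Require Import all_classical all_reals all_analysis.

Set Implicit Arguments.
Unset Strict Implicit.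
Unset Printing Implicit Defensive.

Import Order.TTheory GRing.Theory Num.Theory.
Import numFieldNormedType.Exports.

Local Open Scope classical_set_scope.
Local Open Scope ring_scope.
Local Open Scope quotient_scope.
Local Open Scope complex_scope.

Section Nets.
Variable R : realType.

Record param := Param { pval :> R; pvalP : 0 < pval <= 1 }.
HB.instance Definition _ := [isSub for pval].
HB.instance Definition _ := [Choice of param by <:].

Lemma param1_subproof : 0 < (1 : R) <= 1. Proof. by rewrite ltr01 lexx. Qed.
HB.instance Definition _ := isPointed.Build param (Param param1_subproof).

Lemma param_gt0 (e : param) : 0 < pval e. Proof. by case/andP: (pvalP e). Qed.
Lemma param_le1 (e : param) : pval e <= 1. Proof. by case/andP: (pvalP e). Qed.

(* The filter "e --> 0" on (0, 1]. *)
Definition near_zero : set_system param :=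
  filter_from [set d : R | 0 < d] (fun d => [set e : param | pval e < d]).

Lemma near_zero_filter : Filter near_zero.
Proof.
apply: filter_from_filter; first by exists 1 => /=.
move=> i j /= i0 j0; exists (Num.min i j) => /=; first by rewrite lt_min i0 j0.
by move=> e /=; rewrite lt_min => /andP[].
Qed.
#[global] Existing Instance near_zero_filter.
Canonical near_zero_filter_on := FilterType near_zero near_zero_filter.

Lemma near_zero_proper : ProperFilter near_zero.
Proof.
apply: filter_from_proper => d /= d0.
have h : 0 < Num.min 1 (d / 2) <= 1.
  by rewrite lt_min ltr01 divr_gt0//= ge_min lexx.
exists (Param h) => /=.
by rewrite gt_min [X in _ || X]ltr_pdivrMr// ltr_pMr// ltr1n orbT.
Qed.

(* Nets are indexed by (0, 1] itself; R[i] plays the role of the field of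
   complex numbers, and Normc.normc is its modulus with values in R. *)
Definition net : Type := param -> R[i].
HB.instance Definition _ := GRing.ComNzRing.on net.

Definition absnet (c : net) : param -> R := fun e => Normc.normc (c e).

Definition growth (c : net) (g : param -> R) : Prop :=
  absnet c =O_ near_zero g.

Lemma absnet_ge0 (c : net) e : 0 <= absnet c e.
Proof. by rewrite /absnet; case: (c e) => a b; rewrite sqrtr_ge0. Qed.

Lemma growthP (c : net) (g : param -> R) :
  growth c g <-> exists2 K : R, 0 < K &
    exists2 d : R, 0 < d &
      forall e, pval e < d -> absnet c e <= K * `|g e|.
Proof.
rewrite /growth eqO_exP; split=> -[K K0] [d d0 h]; exists K => //; exists d => //.
  by move=> e ed; have := h e ed; rewrite ger0_norm ?absnet_ge0.
by move=> e ed; rewrite ger0_norm ?absnet_ge0//; exact: h.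
Qed.

Lemma growthB (c1 c2 : net) g : growth c1 g -> growth c2 g ->
  growth (c1 - c2) g.
Proof.
move=> /growthP[K1 K10 [d1 d10 h1]] /growthP[K2 K20 [d2 d20 h2]].
apply/growthP; exists (K1 + K2); first exact: addr_gt0.
exists (Num.min d1 d2); first by rewrite lt_min d10.
move=> e; rewrite lt_min => /andP[/h1 {}h1 /h2 {}h2].
rewrite mulrDl; apply: le_trans (lerD h1 h2); rewrite /absnet.
by apply: le_trans (le_normcD _ _) _; rewrite normcN.
Qed.

Lemma growthM (c1 c2 : net) g1 g2 : growth c1 g1 -> growth c2 g2 ->
  growth (c1 * c2) (fun e => g1 e * g2 e).
Proof.
move=> /growthP[K1 K10 [d1 d10 h1]] /growthP[K2 K20 [d2 d20 h2]].
apply/growthP; exists (K1 * K2); first exact: mulr_gt0.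
exists (Num.min d1 d2); first by rewrite lt_min d10.
move=> e; rewrite lt_min => /andP[/h1 {}h1 /h2 {}h2].
rewrite normrM mulrACA /absnet Normc.normcM.
by apply: ler_pM => //; exact: absnet_ge0.
Qed.

Lemma growth_le (c : net) g1 g2 : (forall e, `|g1 e| <= `|g2 e|) ->
  growth c g1 -> growth c g2.
Proof.
move=> g12 /growthP[K K0 [d d0 h]]; apply/growthP; exists K => //; exists d => //.
by move=> e /h /le_trans; apply; rewrite ler_pM2l.
Qed.

Definition moderate (c : net) : Prop :=
  exists N : nat, growth c (fun e => pval e ^- N).

Lemma moderate_mono (c : net) N M : (N <= M)%N ->
  growth c (fun e => pval e ^- N) -> growth c (fun e => pval e ^- M).
Proof.
move=> NM; apply: growth_le => e /=; have e0 := param_gt0 e.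
rewrite !ger0_norm ?invr_ge0 ?exprn_ge0 ?(ltW e0)// lef_pV2 ?posrE ?exprn_gt0//.
by rewrite ler_wiXn2l ?(ltW e0) ?param_le1.
Qed.

Definition EM_pred : pred net := fun c => `[< moderate c >].

Lemma EM_subring : subring_closed EM_pred.
Proof.
split.
- apply/asboolP; exists 0%N; apply/growthP; exists 1 => //; exists 1 => // e _.
  by rewrite expr0 invr1 normr1 mulr1 /absnet Normc.normc1.
- move=> c1 c2 /asboolP[N1 h1] /asboolP[N2 h2]; apply/asboolP.
  exists (maxn N1 N2); apply: growthB.
    by apply: moderate_mono h1; rewrite leq_maxl.
  by apply: moderate_mono h2; rewrite leq_maxr.
- move=> c1 c2 /asboolP[N1 h1] /asboolP[N2 h2]; apply/asboolP.
  exists (N1 + N2)%N; apply: growth_le (growthM h1 h2) => e.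
  by rewrite exprD invfM.
Qed.
HB.instance Definition _ := GRing.isSubringClosed.Build net EM_pred EM_subring.

Record EM := MkEM { EM_net :> net; EM_netP : EM_net \in EM_pred }.
HB.instance Definition _ := [isSub for EM_net].
HB.instance Definition _ := [Choice of EM by <:].
HB.instance Definition _ := [SubChoice_isSubComNzRing of EM by <:].

Definition negligible (c : net) : Prop :=
  forall q : nat, growth c (fun e => pval e ^+ q).

Definition N_pred : pred EM := fun c => `[< negligible c >].

Lemma N_pred_closed : idealr_closed N_pred.
Proof.
split.
- apply/asboolP => q; apply/growthP; exists 1 => //; exists 1 => // e _.
  by rewrite /absnet Normc.normc0 mul1r.
- apply/asboolP => /(_ 1%N) /growthP[K K0 [d d0 h]].
  pose m := Num.min 1 (Num.min (d / 2) (K^-1 / 2)).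
  have m01 : 0 < m <= 1.
    by rewrite !lt_min ltr01 !divr_gt0 ?invr_gt0//= ge_min lexx.
  have half (x : R) : 0 < x -> x / 2 < x.
    by move=> x0; rewrite ltr_pdivrMr// ltr_pMr// ltr1n.
  have md : m < d.
    by rewrite !gt_min half// orbT.
  have mK : m < K^-1.
    by rewrite !gt_min half ?invr_gt0// !orbT.
  have := h (Param m01) md; rewrite /absnet Normc.normc1 /= expr1.
  rewrite ger0_norm; last by case/andP: m01 => /ltW.
  by rewrite leNgt -ltr_pdivlMl// mulr1 mK.
- move=> a u v /asboolP hu /asboolP hv; apply/asboolP => q.
  rewrite -[v]opprK; apply: growthB.
    have /asboolP[N hN] := EM_netP a.
    apply: growth_le (growthM hN (hu (N + q)%N)) => e.
    by rewrite exprD mulKf// gt_eqF// exprn_gt0 ?param_gt0.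
  rewrite -[X in growth X]add0r; apply: growthB; last exact: hv.
  apply/growthP; exists 1 => //; exists 1 => // e _.
  by rewrite /absnet Normc.normc0 mul1r.
Qed.
HB.instance Definition _ := isIdealr.Build EM N_pred N_pred_closed.
Definition ideal_N : idealr EM := N_pred.

Definition Ctilde : Type := {ideal_quot ideal_N}.
HB.instance Definition _ := GRing.ComNzRing.on Ctilde.

Definition gclass (c : EM) : Ctilde := \pi_{ideal_quot ideal_N} c.

Definition net_valuation (c : net) : \bar R :=
  ereal_sup [set b%:E | b in [set b : R | growth c (fun e => pval e `^ b)]].

(* Computed on the canonical representative chosen by the quotient; by
   valuation_gclass below, any other representative gives the same value. *)
Definition valuation (c : Ctilde) : \bar R := net_valuation (repr c).

Lemma growth_negligible (c1 c2 : net) (b : R) : negligible (c1 - c2) ->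
  growth c1 (fun e => pval e `^ b) -> growth c2 (fun e => pval e `^ b).
Proof.
move=> h12 h1; rewrite -[c2](subKr c1); apply: growthB => //.
have [q bq] : exists q : nat, b <= q%:R.
  exists (Num.truncn `|b|).+1.
  by apply: le_trans (ler_norm b) _; rewrite ltW// truncnS_gt.
apply: growth_le (h12 q) => e; have e0 := param_gt0 e.
rewrite !ger0_norm ?powR_ge0 ?exprn_ge0 ?(ltW e0)// -powR_mulrn ?(ltW e0)//.
by rewrite ger_powR// e0 param_le1.
Qed.

Lemma valuation_gclass (c : EM) : valuation (gclass c) = net_valuation c.
Proof.
have /asboolP h : repr (gclass c) - c \in ideal_N.
  by rewrite Quotient.idealrBE reprK.
have h' : negligible (c - repr (gclass c) : EM).
  move=> q; rewrite -opprB -[X in growth X]add0r.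
  apply: growthB; last exact: h.
  apply/growthP; exists 1 => //; exists 1 => // e _.
  by rewrite /absnet Normc.normc0 mul1r.
by congr ereal_sup; congr image; apply/seteqP; split=> b /=;
  apply: growth_negligible.
Qed.

Lemma valuation_gtNy (c : Ctilde) : (-oo < valuation c)%E.
Proof.
have /asboolP[N hN] := EM_netP (repr c).
apply: (@lt_le_trans _ _ (- N%:R)%:E); first exact: ltNyr.
apply: ereal_sup_ubound; exists (- N%:R) => //=.
apply: growth_le hN => e; have e0 := param_gt0 e.
by rewrite powRN powR_mulrn// ltW.
Qed.

(* exp (- v), equal to 0 when v = +oo;
   fine loses nothing here: - valuation c < +oo by valuation_gtNy. *)
Definition enorm (c : Ctilde) : R := fine (expeR (- valuation c)).

Definition power_net (c : R[i]) (a : R) : net := fun e => c * (pval e `^ a)%:C.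

Lemma power_net_EM (c : R[i]) (a : R) : power_net c a \in EM_pred.
Proof.
apply/asboolP; pose N := (Num.truncn `|a|).+1.
have aN : - N%:R <= a.
  rewrite lerNl; apply: le_trans (ler_norm _) _.
  by rewrite normrN ltW// truncnS_gt.
exists N; apply/growthP; exists (1 + Normc.normc c).
  by rewrite ltr_pwDl// (absnet_ge0 (fun=> c) point).
exists 1 => // e _; have e0 := param_gt0 e.
rewrite /absnet /power_net Normc.normcM ger0_norm ?invr_ge0 ?exprn_ge0 ?(ltW e0)//.
have -> : Normc.normc (pval e `^ a)%:C = pval e `^ a.
  by rewrite /= expr0n addr0 sqrtr_sqr ger0_norm// powR_ge0.
apply: ler_pM; [exact: (absnet_ge0 (fun=> c) point)|exact: powR_ge0| |].
  by rewrite lerDr.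
by rewrite -powR_mulrn ?(ltW e0)// -powRN ger_powR// e0 param_le1.
Qed.

(* The class of the net (c * e ^ a)_e. *)
Definition gpower (c : R[i]) (a : R) : Ctilde :=
  gclass (MkEM (power_net_EM c a)).

Record ultra_pseudo_norm (G : lmodType Ctilde) (P : G -> R) : Prop := {
  upn_ge0 : forall u, 0 <= P u;
  upn_eq0 : forall u, P u = 0 <-> u = 0;
  upn_scale : forall (l : Ctilde) u, P (l *: u) <= enorm l * P u;
  upn_power : forall (c : R[i]) (a : R) u,
    c != 0 -> P (gpower c a *: u) = expR (- a) * P u;
  upn_ultra : forall u v, P (u + v) <= Num.max (P u) (P v)
}.

Definition complete_metric (G : zmodType) (P : G -> R) : Prop :=
  forall u : nat -> G,
    (forall r : R, 0 < r ->
      exists N, forall m n, (N <= m)%N -> (N <= n)%N -> P (u m - u n) < r) ->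
    exists l : G, forall r : R, 0 < r ->
      exists N, forall n, (N <= n)%N -> P (u n - l) < r.

Definition Banach_module (G : lmodType Ctilde) (P : G -> R) : Prop :=
  ultra_pseudo_norm P /\ complete_metric P.

Definition equivalent_upn (G : lmodType Ctilde) (P Q : G -> R) : Prop :=
  exists C1 C2 : R, [/\ 0 < C1, 0 < C2 &
    forall u, C1 * P u <= Q u <= C2 * P u].

End Nets.

(* Main.v *)
Require Import Defs.
From mathcomp Require Import all_boot all_order all_algebra.
From mathcomp Require Import generic_quotient ring_quotient complex lra.
From mathcomp Require Import all_classical all_reals all_analysis.

(** The statement is the open mapping theorem for the identity map from
    (G, P) to (G, Q), which is continuous because Q <= C P.  Completeness of Q
    enters through a Baire argument: the sets {P <= n} cover G, so one of them
    is Q-dense in some Q-ball (ultrametric_Baire); as {P <= n} is an additive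
    subgroup, that ball can be moved to the origin (unit_ball_adherent).
    Multiplication by the class of (e ^ a)_e is invertible and scales both P
    and Q exactly by exp (- a), so the density holds at every scale
    (small_ball_adherent).  Completeness of P enters through successive
    approximation: an element u of the Q-ball is the Q-sum of a series whose
    k-th term has P at most M exp (- k); the series also converges for P, and
    the ultrametric inequality bounds P u by M, the bound of the first term
    (small_ball_bounded).  Rescaling an arbitrary nonzero u into the Q-ball
    yields P u <= K Q u. *)

Import Order.TTheory GRing.Theory Num.Theory.

Local Open Scope ring_scope.

(** * The scalars [c e^a] *)

Lemma gclass_is_rmorphism (R : realType) :
  [/\ gclass 1 = 1 :> Ctilde R, forall c : Defs.EM R, gclass (- c) = - gclass c
    & forall c d : Defs.EM R, gclass (c * d) = gclass c * gclass d].
Proof.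
pose f : {rmorphism Defs.EM R -> Ctilde R} := \pi_({ideal_quot (ideal_N R)})%qT.
by split=> [|c|c d]; [exact: (rmorph1 f)|exact: (rmorphN f)|exact: (rmorphM f)].
Qed.

Lemma gpowerM (R : realType) (c d : R[i]%C) (a b : R) :
  gpower c a * gpower d b = gpower (c * d) (a + b).
Proof.
have [_ _ gM] := gclass_is_rmorphism R.
rewrite -gM; congr gclass; apply: val_inj; apply: funext => e /=.
transitivity (power_net c a e * power_net d b e); first by [].
rewrite /power_net powRD; last by apply/implyP => _; rewrite gt_eqF ?param_gt0.
by rewrite mulrACA -rmorphM.
Qed.

Lemma gpower_cst1 (R : realType) : gpower (1 : R[i]%C) (0 : R) = 1.
Proof.
have [g1 _ _] := gclass_is_rmorphism R.
rewrite -g1; congr gclass; apply: val_inj; apply: funext => e /=.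
by rewrite /power_net powRr0 mul1r.
Qed.

Lemma gpower_cstN1 (R : realType) : gpower (-1 : R[i]%C) (0 : R) = -1.
Proof.
have [g1 gN _] := gclass_is_rmorphism R.
rewrite -g1 -gN; congr gclass; apply: val_inj; apply: funext => e /=.
by rewrite /power_net powRr0 mulr1.
Qed.

(** * Ultra-pseudo-norms as ultrametrics *)

Lemma upn0 {R : realType} {G : lmodType (Ctilde R)} {P : G -> R}
  (hP : ultra_pseudo_norm P) : P 0 = 0.
Proof. exact/(upn_eq0 hP). Qed.

Lemma upnN {R : realType} {G : lmodType (Ctilde R)} {P : G -> R}
  (hP : ultra_pseudo_norm P) u : P (- u) = P u.
Proof.
rewrite -scaleN1r -gpower_cstN1 (upn_power hP) ?oppr_eq0 ?oner_eq0//.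
by rewrite oppr0 expR0 mul1r.
Qed.

Lemma upnBC {R : realType} {G : lmodType (Ctilde R)} {P : G -> R}
  (hP : ultra_pseudo_norm P) u v : P (u - v) = P (v - u).
Proof. by rewrite -(upnN hP) opprB. Qed.

Lemma upn_distl {R : realType} {G : lmodType (Ctilde R)} {P : G -> R}
  (hP : ultra_pseudo_norm P) v u w :
  P (u - w) <= Num.max (P (u - v)) (P (v - w)).
Proof. by rewrite -(subrKA v u); exact: (upn_ultra hP). Qed.

Lemma upn_gpower {R : realType} {G : lmodType (Ctilde R)} {P : G -> R}
  (hP : ultra_pseudo_norm P) (a : R) u :
  P (gpower 1 a *: u) = expR (- a) * P u.
Proof. by apply: (upn_power hP); rewrite oner_eq0. Qed.

(** In an ultrametric the step sizes need only tend to zero for a sequence to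
    be Cauchy, and no summation occurs: a single step bounds the whole tail. *)
Lemma upn_step_limit {R : realType} {G : lmodType (Ctilde R)} {P : G -> R}
  (hP : Banach_module P) (s : nat -> G) (d : nat -> R) :
  (forall k, P (s k.+1 - s k) <= d k) ->
  (forall k, d k.+1 <= d k) ->
  (forall e, 0 < e -> exists k, d k < e) ->
  exists l, forall k, P (s k - l) <= d k.
Proof.
case: hP => hP cP step dS d0.
have dge0 k : 0 <= d k by apply: le_trans (step k); exact: (upn_ge0 hP).
have dmono k m : (k <= m)%N -> d m <= d k.
  by move=> /subnK <-; elim: (m - k)%N => // j IH; exact: le_trans (dS _) IH.
have tail k m : (k <= m)%N -> P (s m - s k) <= d k.
  move=> /subnK <-; elim: (m - k)%N => [|j IH]; first by rewrite subrr (upn0 hP).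
  apply: le_trans (upn_distl hP (s (j + k)%N) _ _) _.
  by rewrite ge_max IH andbT; apply: le_trans (step _) _; exact/dmono/leq_addl.
have [|l hl] := cP s.
  move=> e /d0[k ke]; exists k => m n km kn.
  apply: le_lt_trans (upn_distl hP (s k) _ _) _.
  by rewrite gt_max (upnBC hP (s k)) !(le_lt_trans _ ke) ?tail.
exists l => k; apply/ler_addgt0Pr => e e0.
have [N hN] := hl e e0.
apply: le_trans (upn_distl hP (s (maxn k N)) _ _) _.
rewrite ge_max (upnBC hP (s k)); apply/andP; split.
  by apply: le_trans (tail _ _ (leq_maxl _ _)) _; rewrite lerDl ltW.
by apply: le_trans (ltW (hN _ (leq_maxr _ _))) _; rewrite lerDr.
Qed.

(** * Baire category *)

(** If every A n were nowhere dense, one could pick nested balls, the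
    (n + 1)-st avoiding A n, with radii tending to zero; their common point
    would lie in no A n. *)
Lemma ultrametric_Baire {R : realType} {G : lmodType (Ctilde R)} {Q : G -> R}
  (hQ : Banach_module Q) (A : nat -> set G) :
  (forall u, exists n, A n u) ->
  exists n v0 r, 0 < r /\ forall v, Q (v - v0) < r ->
    forall s, 0 < s -> exists2 b, A n b & Q (v - b) < s.
Proof.
move=> cover; apply: contrapT => noball.
have avoid (x : nat * (G * R)) : exists y : G * R, 0 < x.2.2 ->
    [/\ Q (y.1 - x.2.1) <= x.2.2, 0 < y.2, y.2 <= x.2.2, y.2 <= x.1.+1%:R^-1
      & forall b, A x.1 b -> y.2 < Q (y.1 - b)].
  case: x => n [v0 r] /=; have [r0|nr0] := pselect (0 < r); last first.
    by exists (0, 0).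
  apply: contrapT => nex; apply: noball; exists n, v0, r; split=> // v vr s s0.
  apply: contrapT => far; apply: nex.
  have n0 : 0 < n.+1%:R^-1 :> R by rewrite invr_gt0 ltr0n.
  exists (v, Num.min (s / 2) (Num.min r n.+1%:R^-1)) => _ /=; split.
  - exact: ltW.
  - by rewrite !lt_min r0 n0 divr_gt0.
  - by rewrite !ge_min lexx orbT.
  - by rewrite !ge_min lexx !orbT.
  - move=> b Ab; rewrite gt_min; apply/orP; left.
    have sb : s <= Q (v - b) by rewrite leNgt; apply/negP => ?; apply: far; exists b.
    by apply: lt_le_trans sb; lra.
have {avoid} [f hf] := choice avoid.
(* centre and radius of the n-th ball *)
pose fix ball n := if n is m.+1 then f (m, ball m) else (0 : G, 1 : R).
have rad0 n : 0 < (ball n).2 by elim: n => [|n /(hf (n, _))[]//]; exact: ltr01.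
have ballS n := hf (n, ball n) (rad0 n).
have [|||l hl] := upn_step_limit hQ (fun n => (ball n).1) (fun n => (ball n).2).
- by move=> n; have [] := ballS n.
- by move=> n; have [] := ballS n.
- move=> e e0; exists (Num.truncn e^-1).+1.
  have [_ _ _ small _] := ballS (Num.truncn e^-1).
  apply: le_lt_trans small _.
  by rewrite invf_plt ?posrE ?ltr0n// truncnS_gt.
have [n Al] := cover l.
have [_ _ _ _ /(_ l Al) far] := ballS n.
by have := lt_le_trans far (hl n.+1); rewrite ltxx.
Qed.

(** * Open mapping *)

Lemma expRNn_small {R : realType} (c e : R) : 0 < c -> 0 < e ->
  exists k : nat, c * expR (- k%:R) < e.
Proof.
move=> c0 e0; exists (Num.truncn (c / e)).
set k := Num.truncn _.
have ke : c / e < expR k%:R.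
  apply: lt_le_trans (truncnS_gt _) _.
  by rewrite -natr1 addrC; exact: expR_ge1Dx.
by rewrite expRN ltr_pdivrMr ?expR_gt0// mulrC -ltr_pdivrMr.
Qed.

Section OpenMapping.
Context {R : realType} {G : lmodType (Ctilde R)} {P Q : G -> R}.
Hypotheses (hP : Banach_module P) (hQ : Banach_module Q).

(** Differences of two points of the ball found by Baire's argument fill the
    ball of the same radius about the origin, and their approximants stay in
    {P <= n} since P is ultrametric. *)
Lemma unit_ball_adherent : exists M r : R, [/\ 0 < M, 0 < r &
  forall u, Q u < r -> forall s, 0 < s ->
    exists2 b, P b <= M & Q (u - b) < s].
Proof.
have [uP _] := hP; have [uQ _] := hQ.
have [|n [v0 [r [r0 dense]]]] := ultrametric_Baire hQ (fun n u => P u <= n.+1%:R).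
  by move=> u; exists (Num.truncn (P u)); rewrite ltW// truncnS_gt.
exists n.+1%:R, r; split=> // u ur s s0.
have [|b bM bs] := dense (u + v0) _ s s0; first by rewrite addrK.
have [|c cM cs] := dense v0 _ s s0; first by rewrite subrr (upn0 uQ).
exists (b - c).
  by apply: le_trans (upn_ultra uP _ _) _; rewrite ge_max (upnN uP) bM.
have -> : u - (b - c) = (u + v0 - b) + - (v0 - c).
  by rewrite [RHS]addrAC addrKA opprK opprB addrA.
by apply: le_lt_trans (upn_ultra uQ _ _) _; rewrite gt_max (upnN uQ) bs.
Qed.

(** Multiplication by [e^a] scales P and Q by the same factor, and [e^(-a)]
    inverts it, so approximability passes from the ball of radius r to each
    ball of radius r exp (- a). *)
Lemma small_ball_adherent : exists M r : R, [/\ 0 < M, 0 < r &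
  forall (a : R) u, Q u < r * expR (- a) -> forall s, 0 < s ->
    exists2 b, P b <= M * expR (- a) & Q (u - b) < s].
Proof.
have [uP _] := hP; have [uQ _] := hQ.
have [M [r [M0 r0 adh]]] := unit_ball_adherent.
exists M, r; split=> // a u ur s s0.
have ea0 : 0 < expR (- a) := expR_gt0 _.
have [||b bM bs] := adh (gpower 1 (- a) *: u) _ (s / expR (- a)).
- by rewrite (upn_gpower uQ) opprK -ltr_pdivlMl ?expR_gt0// -expRN mulrC.
- exact: divr_gt0.
exists (gpower 1 a *: b); first by rewrite (upn_gpower uP) mulrC ler_pM2r.
have -> : u = gpower 1 a *: (gpower 1 (- a) *: u).
  by rewrite scalerA gpowerM mulr1 subrr gpower_cst1 scale1r.
by rewrite -scalerBr (upn_gpower uQ) mulrC -ltr_pdivlMr.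
Qed.

Hypothesis hPQ : exists2 C : R, 0 < C & forall u : G, Q u <= C * P u.

(** Successive approximation.  The remainders tend to 0 for Q by choice of the
    approximants; the partial sums converge for P because their increments
    are at most M exp (- k).  As Q <= C P, the P-limit is also the Q-limit,
    hence equals u, and the first increment bounds P u. *)
Lemma small_ball_bounded : exists M r : R, [/\ 0 < M, 0 < r &
  forall u, Q u < r -> P u <= M].
Proof.
have [uP _] := hP; have [uQ _] := hQ; have [C C0 QP] := hPQ.
have [M [r [M0 r0 adh]]] := small_ball_adherent.
exists M, r; split=> // u ur.
have expS k : expR (- k.+1%:R) <= expR (- k%:R) :> R.
  by rewrite ler_expR lerN2 ler_nat.
have approx (x : nat * G) : exists b, Q x.2 < r * expR (- x.1%:R) ->
    P b <= M * expR (- x.1%:R) /\ Q (x.2 - b) < r * expR (- x.1.+1%:R).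
  have [vr|nvr] := pselect (Q x.2 < r * expR (- x.1%:R)); last by exists 0.
  have [|b bM bs] := adh _ _ vr (r * expR (- x.1.+1%:R)).
    by rewrite mulr_gt0 ?expR_gt0.
  by exists b.
have {approx} [f hf] := choice approx.
(* rest k is what remains of u after subtracting the first k approximants *)
pose fix rest k := if k is j.+1 then rest j - f (j, rest j) else u.
have restQ k : Q (rest k) < r * expR (- k%:R).
  by elim: k => [|k /(hf (k, _))[]//]; rewrite /= oppr0 expR0 mulr1.
have [|||l hl] := upn_step_limit hP (fun k => u - rest k)
    (fun k => M * expR (- k%:R)).
- move=> k; have [bM _] := hf (k, rest k) (restQ k).
  have -> // : u - rest k.+1 - (u - rest k) = f (k, rest k).
  by rewrite /= [u - (_ - _)]addrC addrKA opprK opprB subrK.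
- by move=> k; rewrite ler_pM2l.
- by move=> e; exact: expRNn_small.
have -> : u = l.
  apply/eqP; rewrite -subr_eq0; apply/eqP/(upn_eq0 uQ)/le_anti.
  rewrite (upn_ge0 uQ) andbT; apply/ler_addgt0Pr => e e0; rewrite add0r.
  have rCM0 : 0 < r + C * M by rewrite addr_gt0// mulr_gt0.
  have [k ke] := expRNn_small _ _ rCM0 e0.
  have ek0 : 0 < expR (- k%:R) :> R := expR_gt0 _.
  apply: le_trans (upn_distl uQ (u - rest k) _ _) _.
  apply: (le_trans _ (ltW ke)); rewrite ge_max subKr; apply/andP; split.
    apply: le_trans (ltW (restQ k)) _.
    by rewrite ler_pM2r// lerDl mulr_ge0 ?ltW.
  apply: le_trans (QP _) _; rewrite mulrDl -mulrA.
  apply: ler_wpDl; first by rewrite mulr_ge0 ?ltW.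
  by rewrite ler_pM2l.
(* the partial sum of index 0 is u - u = 0 *)
by have := hl 0%N; rewrite /= subrr sub0r (upnN uP) oppr0 expR0 mulr1.
Qed.

End OpenMapping.

Theorem proposition4p8 (R : realType) (G : lmodType (Ctilde R)) (P Q : G -> R)
  (hP : Banach_module P) (hQ : Banach_module Q)
  (hPQ : exists2 C : R, 0 < C & forall u : G, Q u <= C * P u) :
  equivalent_upn P Q.
Proof.
have [uP _] := hP; have [uQ _] := hQ.
have [M [r [M0 r0 bound]]] := small_ball_bounded hP hQ hPQ.
have [C C0 QP] := hPQ.
exists (r / 2 / M), C; split=> //; first by rewrite !divr_gt0.
move=> u; rewrite QP andbT.
have [->|/eqP u0] := pselect (u = 0); first by rewrite (upn0 uP) (upn0 uQ) mulr0.
have Qu0 : 0 < Q u.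
  rewrite lt_def (upn_ge0 uQ) andbT.
  by apply: contra u0 => /eqP/(upn_eq0 uQ) ->.
(* t is the factor that brings u to Q-size r / 2, inside the ball *)
pose t := r / 2 / Q u.
have t0 : 0 < t by rewrite !divr_gt0.
have et : expR (- - ln t) = t by rewrite opprK lnK.
have := bound (gpower 1 (- ln t) *: u).
rewrite (upn_gpower uP) (upn_gpower uQ) et divfK ?gt_eqF//.
have -> : (r / 2 < r) = true by lra.
move=> /(_ isT); rewrite /t mulrAC ler_pdivrMr// => tP.
by rewrite mulrAC ler_pdivrMr// (mulrC (Q u)).
Qed.
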